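(* Let $k\ge 2$, let $\mathcal{C}$ be a (nondegenerate) $[\mathbf{n},k,d]_{q^m/q}$ sum-rank metric code with $\mathbf{n}=(n_1,\ldots,n_t)$ and $N=n_1+\cdots+n_t$, and let $U=(U_1,\ldots,U_t)$ be a system associated with $\mathcal{C}$. Assume that $U_1\cap\cdots\cap U_t$ does not contain any $1$-dimensional $\mathbb{F}_{q^m}$-subspace of $\mathbb{F}_{q^m}^k$. Then: (1) Up to equivalence, the geometric dual $\mathcal{C}^{\perp_{\mathcal{G}}}$ does not depend on the choice of the associated system nor on the choice of the code in the equivalence class of $\mathcal{C}$; hence $\perp_{\mathcal{G}}$ is well-defined on equivalence classes. (2) $\mathcal{C}^{\perp_{\mathcal{G}}}$ has parameters $[(km-n_1,\ldots,km-n_t),k]_{q^m/q}$. (3) For every $r\in\{1,\ldots,k-1\}$ the generalized sum-rank weight enumerators satisfy (as Laurent polynomials in $X,Y$) \[ W^{r}_{\mathcal{C}^{\perp_{\mathcal{G}}}}(X,Y)=X^{tmk-trm-N}\,Y^{trm-N}\,W^{k-r}_{\mathcal{C}}(X,Y). \] (4) In particular, \[ d_1(\mathcal{C})=d_{k-1}(\mathcal{C}^{\perp_{\mathcal{G}}})+N-t(k-1)m. \]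
   Context: Let $q$ be a prime power and $\mathbf{n}=(n_1,\ldots,n_t)$, $N=\sum n_i$, $\mathbb{F}_{q^m}^{\mathbf{n}}=\bigoplus_{i=1}^t\mathbb{F}_{q^m}^{n_i}$ (order of block lengths is immaterial here). The rank of $v\in\mathbb{F}_{q^m}^n$ is the $\mathbb{F}_q$-dimension of the $\mathbb{F}_q$-span of its entries; the sum-rank weight of $x=(x_1,\ldots,x_t)$ is $w(x)=\sum_i\mathrm{rk}(x_i)$ and the distance is $w(x-y)$. An $[\mathbf{n},k]_{q^m/q}$ code is a $k$-dimensional $\mathbb{F}_{q^m}$-subspace of $\mathbb{F}_{q^m}^{\mathbf{n}}$; write $[\mathbf{n},k,d]_{q^m/q}$ if its minimum distance is $d$. A generator matrix is $G=(G_1|\cdots|G_t)$ with $G_i\in\mathbb{F}_{q^m}^{k\times n_i}$ and rows a basis of the code; the code is nondegenerate if the columns of each $G_i$ are $\mathbb{F}_q$-independent. All codes are assumed nondegenerate. Two codes are equivalent if one is mapped to the other by an $\mathbb{F}_{q^m}$-linear isometry of the ambient space, i.e. a map $(x_1,\ldots,x_t)\mapsto(a_1x_{\pi(1)}A_1,\ldots,a_tx_{\pi(t)}A_t)$ with $a_i\in\mathbb{F}_{q^m}^*$, $A_i\in\mathrm{GL}(n_i,\mathbb{F}_q)$ and $\pi$ a permutation of blocks of equal length. Systems: an $[\mathbf{n},k]_{q^m/q}$-system is an ordered tuple $(U_1,\ldots,U_t)$ of $\mathbb{F}_q$-subspaces of $\mathbb{F}_{q^m}^k$ with $\dim_{\mathbb{F}_q}U_i=n_i$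 and $\langle U_1,\ldots,U_t\rangle_{\mathbb{F}_{q^m}}=\mathbb{F}_{q^m}^k$. If $G=(G_1|\cdots|G_t)$ generates $\mathcal{C}$ and $U_i$ is the $\mathbb{F}_q$-span of the columns of $G_i$, then $(U_1,\ldots,U_t)$ is a system associated with $\mathcal{C}$. Conversely, a code associated with a system is one generated by $(G_1|\cdots|G_t)$ where the columns of $G_i$ form an $\mathbb{F}_q$-basis of $U_i$. Associated systems and codes are understood up to equivalence, where systems $(U_i)$ and $(V_i)$ are equivalent if there are $\varphi\in\mathrm{GL}(k,\mathbb{F}_{q^m})$, a permutation $\rho$ and $a_i\in\mathbb{F}_{q^m}^*$ with $\varphi(U_i)=a_iV_{\rho(i)}$ for all $i$. Geometric dual: fix a nondegenerate reflexive sesquilinear form $\sigma$ on $V=\mathbb{F}_{q^m}^k$ and let $\sigma'(x,y)=\mathrm{Tr}_{q^m/q}(\sigma(x,y))$, regarded as a nondegenerate reflexive sesquilinear form on $V$ seen as a $km$-dimensional $\mathbb{F}_q$-space. For an $\mathbb{F}_q$-subspace $U$ of $V$ let $U^{\perp'}$ be its orthogonal complement with respect to $\sigma'$, of $\mathbb{F}_q$-dimension $km-\dim_{\mathbb{F}_q}U$. If $\mathcal{C}$ has associated system $(U_1,\ldots,U_t)$ such that $U_1\cap\cdots\cap U_t$ contains no $1$-dimensional $\mathbb{F}_{q^m}$-subspace, a geometric dual $\mathcal{C}^{\perp_{\mathcal{G}}}$ is any code associated with the system $(U_1^{\perp'},\ldots,U_t^{\perp'})$. Generalized weights: for a code $\mathcal{C}$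 with associated system $(U_1,\ldots,U_t)$, total length $N$, and $r\in\{1,\ldots,k\}$, $d_r(\mathcal{C})=N-\max_H\sum_{i=1}^t\dim_{\mathbb{F}_q}(U_i\cap H)$, with $H$ over $\mathbb{F}_{q^m}$-subspaces of $\mathbb{F}_{q^m}^k$ of codimension $r$. The $r$-th generalized sum-rank weight enumerator is $W^r_{\mathcal{C}}(X,Y)=\sum_{w=0}^NA^r_wX^{N-w}Y^w$, where $A^r_w$ is the number of $\mathbb{F}_{q^m}$-subspaces $H$ of $\mathbb{F}_{q^m}^k$ of codimension $r$ with $w=N-\sum_{i=1}^t\dim_{\mathbb{F}_q}(U_i\cap H)$. (For $\mathcal{C}^{\perp_{\mathcal{G}}}$ the total length is $tmk-N$.) *)

(* Defs.v *)
From HB Require Import structures.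
From mathcomp Require Import all_boot all_order all_fingroup all_algebra all_field.

Set Implicit Arguments.
Unset Strict Implicit.
Unset Printing Implicit Defensive.

Import GRing.Theory.
Local Open Scope ring_scope.

(* Over a finite field there are finitely many subspaces; this makes counting
   them, and maximising over them, available. *)
HB.instance Definition _ (K : finFieldType) (vT : vectType K) :=
  isCountable.Build {vspace vT}
    (pcan_pickleK (can_pcan (@VectorInternalTheory.vs2mxK K vT))).
HB.instance Definition _ (K : finFieldType) (vT : vectType K) :=
  isFinite.Build {vspace vT}
    (pcan_enumP (can_pcan (@VectorInternalTheory.vs2mxK K vT))).

Section Fcolumns.
Import VectorInternalTheory.
Variables (F : finFieldType) (L : fieldExtType F).

(* 'cV[L]_k viewed as a vector space over F.  The alias keeps its subspaces
   {vspace Fcol L k}, which are F-subspaces, apart from the L-subspaces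
   {vspace 'cV[finvect_type L]_k}. *)
Definition Fcol (k : nat) : predArgType := 'cV[finvect_type L]_k.

Variable k : nat.

HB.instance Definition _ := GRing.Zmodule.on (Fcol k).
HB.instance Definition _ := Finite.on (Fcol k).

Definition Fcol_scale (c : F) (v : Fcol k) : Fcol k :=
  (c%:A : finvect_type L) *: (v : 'cV[finvect_type L]_k).

Fact Fcol_scaleA a b v : Fcol_scale a (Fcol_scale b v) = Fcol_scale (a * b) v.
Proof. by rewrite /Fcol_scale scalerA mulr_algl scalerA. Qed.
Fact Fcol_scale1 : left_id 1 Fcol_scale.
Proof. by move=> v; rewrite /Fcol_scale !scale1r. Qed.
Fact Fcol_scaleDr : right_distributive Fcol_scale +%R.
Proof. by move=> a u v; rewrite /Fcol_scale scalerDr. Qed.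
Fact Fcol_scaleDl v : {morph Fcol_scale^~ v : a b / a + b}.
Proof. by move=> a b; rewrite /Fcol_scale -scalerDl -scalerDl. Qed.

HB.instance Definition _ := GRing.Zmodule_isLmodule.Build F (Fcol k)
  Fcol_scaleA Fcol_scale1 Fcol_scaleDr Fcol_scaleDl.

Fact Fcol_vect_iso :
  Vector.axiom (dim {ffun 'I_k -> finvect_type L}) (Fcol k).
Proof.
pose f (v : Fcol k) : {ffun 'I_k -> finvect_type L} :=
  [ffun i => (v : 'cV[finvect_type L]_k) i 0].
pose g (w : {ffun 'I_k -> finvect_type L}) : Fcol k := \col_i w i.
have fK : cancel f g by move=> v; apply/colP => i; rewrite mxE ffunE.
have gK : cancel g f by move=> w; apply/ffunP => i; rewrite ffunE mxE.
exists (v2r \o f); last first.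
  exists (g \o r2v) => v /=.
    by rewrite v2rK fK.
  by rewrite gK r2vK.
move=> a u v /=; rewrite -linearP.
congr v2r; apply/ffunP => i.
by rewrite !ffunE !mxE mulr_algl.
Qed.

HB.instance Definition _ :=
  Lmodule_hasFinDim.Build F (Fcol k) Fcol_vect_iso.

End Fcolumns.

Section SumRank.
Variables (F : finFieldType) (L0 : fieldExtType F).
(* The same field extension, with its canonical finite type structure. *)
Local Notation L := (finvect_type L0).

(* The ambient space is 'rV[L]_(\sum_i n i); submxrow x i is the i-th block. *)

Definition rank_wt (n : nat) (v : 'rV[L]_n) : nat :=
  \dim <<[seq v 0%R j | j : 'I_n]>>%VS.

Section Blocks.
Variables (t : nat) (n : 'I_t -> nat).
Local Notation ambient := 'rV[L]_(\sum_i n i).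

Definition sumrank_wt (x : ambient) : nat := (\sum_i rank_wt (submxrow x i))%N.

Definition min_distance (C : {vspace ambient}) (d : nat) : Prop :=
  (exists x y, [/\ x \in C, y \in C, x != y & sumrank_wt (x - y) = d]) /\
  (forall x y, x \in C -> y \in C -> x != y -> (d <= sumrank_wt (x - y))%N).

(* The codes C1 and C2 are equivalent when C2 is the image of C1 under
   x |-> (a_i x_(pi i) A_i)_i; the cast identifies the lengths of the blocks
   pi i and i. *)
Definition block_map (pi : 'S_t) (npi : forall i, n (pi i) = n i)
    (a : 'I_t -> L) (A : forall i, 'M[F]_(n i)) (x : ambient) : ambient :=
  \mxrow_i (a i *: (castmx (erefl 1%N, npi i) (submxrow x (pi i))
                     *m map_mx (in_alg L) (A i))).

Definition code_equiv (C1 C2 : {vspace ambient}) : Prop :=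
  exists (pi : 'S_t) (npi : forall i, n (pi i) = n i)
         (a : 'I_t -> L) (A : forall i, 'M[F]_(n i)),
    [/\ forall i, a i != 0, forall i, A i \in unitmx &
        [set y in C2] = [set block_map npi a A x | x in C1]].

Section Dimension.
Variable k : nat.

Definition block_cols (G : 'M[L]_(k, \sum_i n i)) (i : 'I_t) : seq (Fcol L0 k) :=
  [seq (col j (submxrow G i) : Fcol L0 k) | j : 'I_(n i)].

Definition generator (C : {vspace ambient}) (G : 'M[L]_(k, \sum_i n i)) : Prop :=
  basis_of C [seq row a G | a : 'I_k].

Definition nondegenerate_code (C : {vspace ambient}) : Prop :=
  forall G, generator C G -> forall i, free (block_cols G i).

(* The second condition is about the L-span: the sum is taken in 'cV[L]_k. *)
Definition is_system (U : 'I_t -> {vspace Fcol L0 k}) : Prop :=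
  (forall i, \dim (U i) = n i) /\
  (\sum_i <<(enum (U i) : seq 'cV[L]_k)>>)%VS = fullv :> {vspace 'cV[L]_k}.

End Dimension.
End Blocks.

Section Systems.
Variables (t k : nat).
Implicit Types U V : 'I_t -> {vspace Fcol L0 k}.

Definition system_equiv U V : Prop :=
  exists (phi : 'M[L]_k) (rho : 'S_t) (a : 'I_t -> L),
    [/\ phi \in unitmx, forall i, a i != 0 &
        forall i, [set phi *m (v : 'cV[L]_k) | v in U i]
                = [set a i *: (v : 'cV[L]_k) | v in V (rho i)]].

(* Systems associated with a code, and codes associated with a system, are
   taken up to equivalence: U0 and C0 are the ones read off from G. *)
Definition assoc_system (n : 'I_t -> nat) (C : {vspace 'rV[L]_(\sum_i n i)})
    U : Prop :=
  is_system n U /\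
  exists G U0, [/\ generator C G,
    forall i, U0 i = <<block_cols G i>>%VS & system_equiv U0 U].

Definition assoc_code (n : 'I_t -> nat) U
    (C : {vspace 'rV[L]_(\sum_i n i)}) : Prop :=
  exists (G : 'M[L]_(k, \sum_i n i)) (C0 : {vspace 'rV[L]_(\sum_i n i)}),
    [/\ forall i, basis_of (U i) (block_cols G i),
        C0 = <<[seq row a G | a : 'I_k]>>%VS & code_equiv C0 C].

Definition restr (H : {vspace 'cV[L]_k}) : {vspace Fcol L0 k} :=
  <<(enum H : seq (Fcol L0 k))>>%VS.

Lemma mem_restr (H : {vspace 'cV[L]_k}) (v : 'cV[L]_k) :
  ((v : Fcol L0 k) \in restr H) = (v \in H).
Proof.
apply/idP/idP => [vH|vH]; last by apply: memv_span; rewrite mem_enum.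
rewrite (coord_span (X := in_tuple (enum H : seq (Fcol L0 k))) vH).
apply: (@big_ind (Fcol L0 k) (fun w => (w : 'cV[L]_k) \in H)).
- exact: mem0v.
- by move=> x y; apply: rpredD.
move=> i _; have iH : (in_tuple (enum H))`_i \in H.
  by rewrite -mem_enum; apply: mem_nth; case: i.
exact: rpredZ.
Qed.

Definition no_line U : Prop :=
  forall H : {vspace 'cV[L]_k}, \dim H = 1%N ->
    ~~ (restr H <= \bigcap_i U i)%VS.

Section Weights.
Variables (n : 'I_t -> nat) (U : 'I_t -> {vspace Fcol L0 k}).
Let N := (\sum_i n i)%N.

Definition sys_wt (H : {vspace 'cV[L]_k}) : nat :=
  (N - \sum_i \dim (U i :&: restr H))%N.

Definition gen_weight (r : nat) : nat :=
  (N - \max_(H : {vspace 'cV[L]_k} | (\dim H + r == k)%N)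
         \sum_i \dim (U i :&: restr H))%N.

Definition weight_count (r w : nat) : nat :=
  #|[set H : {vspace 'cV[L]_k} | (\dim H + r == k)%N && (w == sys_wt H)]|.

(* In {poly {poly int}}, X is the inner variable 'X%:P and Y the outer one. *)
Definition weight_enum (r : nat) : {poly {poly int}} :=
  \sum_(w < N.+1)
    (weight_count r w)%:R * ('X%:P ^+ (N - w) * 'X ^+ w).

End Weights.
End Systems.

Section Dual.
Variables (k : nat) (theta : {rmorphism L -> L}).
Variable sigma : {bilinear 'cV[L]_k -> 'cV[L]_k -> L | *%R & theta \; *%R}.

Definition nondeg_form : Prop :=
  forall x, (forall y, sigma x y = 0) -> x = 0.

Definition reflexive_form : Prop :=
  forall x y, sigma x y = 0 -> sigma y x = 0.

Definition trace_form (x y : 'cV[L]_k) : L := galTrace 1 {:L} (sigma x y).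

Lemma trace_formDl x y u :
  trace_form (x + y) u = trace_form x u + trace_form y u.
Proof. by rewrite /trace_form linearDl raddfD. Qed.

Lemma trace_formZl (c : F) x u :
  trace_form (c%:A *: x) u = c *: trace_form x u.
Proof.
rewrite /trace_form linearZl_LR /= /galTrace scaler_sumr.
by apply: eq_bigr => g _; rewrite mulr_algl linearZ.
Qed.

(* sigma is linear in its first argument, so the complement is taken on that
   side. *)
Definition perp (U : {vspace Fcol L0 k}) : {vspace Fcol L0 k} :=
  <<[seq x : Fcol L0 k <- enum (Fcol L0 k)
       | [forall u in U, trace_form x u == 0%R]]>>%VS.

(* The set spanning perp U is already an F-subspace. *)
Lemma mem_perp (U : {vspace Fcol L0 k}) (x : Fcol L0 k) :
  reflect (forall u, u \in U -> trace_form x u = 0) (x \in perp U).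
Proof.
set P := [pred y : Fcol L0 k | [forall u in U, trace_form y u == 0]].
suff -> : (x \in perp U) = P x.
  by apply: (iffP forall_inP) => Px u uU; apply/eqP; apply: Px.
apply/idP/idP => [xP|Px]; last first.
  by apply: memv_span; rewrite mem_filter mem_enum andbT.
rewrite (coord_span (X := in_tuple [seq y <- enum (Fcol L0 k) | P y]) xP).
apply: (@big_ind (Fcol L0 k) (fun y => is_true (P y))).
- by apply/forall_inP => u _; rewrite -(scale0r 0) trace_formZl scale0r.
- move=> y z /forall_inP Py /forall_inP Pz; apply/forall_inP => u uU; apply/eqP.
  have y0 : trace_form y u = 0 by apply/eqP/Py.
  have z0 : trace_form z u = 0 by apply/eqP/Pz.
  by apply: etrans (trace_formDl y z u) _; rewrite y0 z0 addr0.
move=> i _; set y := (in_tuple _)`_i; set c := coord _ _ _.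
have /forall_inP Py : P y.
  have: y \in [seq y <- enum (Fcol L0 k) | P y].
    by apply: mem_nth; case: (i).
  by rewrite mem_filter => /andP[].
apply/forall_inP => u uU; apply/eqP.
have y0 : trace_form y u = 0 by apply/eqP/Py.
by apply: etrans (trace_formZl c y u) _; rewrite y0 scaler0.
Qed.

Definition geometric_dual (t : nat) (n : 'I_t -> nat)
    (C : {vspace 'rV[L]_(\sum_i n i)}) (n' : 'I_t -> nat)
    (D : {vspace 'rV[L]_(\sum_i n' i)}) : Prop :=
  exists U : 'I_t -> {vspace Fcol L0 k},
    [/\ assoc_system C U, no_line U & assoc_code (fun i => perp (U i)) D].

End Dual.

End SumRank.

(* Main.v *)
Require Import Defs.
From HB Require Import structures.
From mathcomp Require Import all_boot all_order all_fingroup all_algebra all_field.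
From mathcomp Require Import zify.

Set Implicit Arguments.
Unset Strict Implicit.
Unset Printing Implicit Defensive.

Import GRing.Theory.
Local Open Scope ring_scope.

(* The geometric dual is a polarity.  A map on subspaces that turns sums into
   intersections, kills the whole space and sends lines to subspaces of
   codimension at most 1 satisfies dim (p U) + dim U = dim V and is injective.
   This covers both the complement for Tr sigma on F-subspaces and the
   complement for sigma on L-subspaces, and the two agree on L-subspaces since
   Tr(c s) = 0 for all c forces s = 0.  Injectivity on a finite type gives
   surjectivity: if the dual system did not span, its L-span would lie in the
   sigma-complement of an L-line, which would then be contained in every U_i.

   For codes, generator matrices translate equivalence of nondegenerate codes
   into equivalence of systems and back; the adjoint of a matrix with respect
   to sigma carries equivalences of systems to their duals.  The enumerators
   are compared through H |-> H^perp, by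
     dim (U_i^perp' :&: H^perp) = km - dim U_i - m dim H + dim (U_i :&: H). *)

(** * Polarities *)

Section Polarity.
Variables (K : fieldType) (V : vectType K) (p : {vspace V} -> {vspace V}).
Hypothesis p0 : p 0 = fullv.
Hypothesis pD : forall A B, p (A + B) = (p A :&: p B)%VS.
Hypothesis pf : p fullv = 0%VS.
Hypothesis p_line : forall u, (\dim {:V} <= (\dim (p <[u]>)).+1)%N.

(** Induction on [\dim A]: splitting a line off [A] intersects the image with the image of that
    line, which costs at most one dimension. *)
Lemma polarity_ge A : (\dim {:V} <= \dim (p A) + \dim A)%N.
Proof.
have [n] := ubnP (\dim A); elim: n A => // n IHn A.
have [-> _|A_neq0 ltAn] := eqVneq A 0%VS; first by rewrite p0 dimv0 addn0.
set u := vpick A; have uA : (<[u]> <= A)%VS by rewrite -memvE memv_pick.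
have dimu : \dim <[u]> = 1%N by rewrite dim_vline vpick0 A_neq0.
have dimA := dimv_cap_compl A <[u]>; rewrite (capv_idPr uA) dimu in dimA.
have <- : (<[u]> + (A :\: <[u]>) = A)%VS.
  by rewrite addvC addv_diff; apply/addv_idPl.
rewrite pD dimv_disjoint_sum; last by rewrite capvC capv_diff.
rewrite -dimA add1n in ltAn.
have := p_line u; have := IHn (A :\: <[u]>)%VS ltAn.
have := dimv_sum_cap (p <[u]>) (p (A :\: <[u]>)%VS).
have := dimvS (subvf (p <[u]> + p (A :\: <[u]>)%VS)).
rewrite dimu; move: (\dim _) (\dim _) (\dim _) (\dim _) (\dim _) (\dim _).
clear; lia.
Qed.

(** The lower bounds for [A] and for a complement of [A] add up to [\dim {:V}]. The two images meet
    in [p fullv = 0], so their dimensions cannot add up to more, and both bounds are equalities. *)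
Lemma dim_polarity A : (\dim (p A) + \dim A = \dim {:V})%N.
Proof.
have := polarity_ge A; have := polarity_ge A^C.
have := dimv_sum_cap (p A) (p A^C).
rewrite -pD addv_complf pf dimv0 dimv_compl.
have := dimvS (subvf (p A + p A^C)); have := dimvS (subvf A).
move: (\dim _) (\dim _) (\dim _) (\dim _) (\dim _); clear.
lia.
Qed.

(** The inclusion makes [p (A + B)] equal to [p B], so [A + B] has the same dimension as [B]. *)
Lemma polarity_sub A B : (p B <= p A)%VS -> (A <= B)%VS.
Proof.
move/capv_idPr; rewrite -pD => pAB.
have := dim_polarity (A + B); rewrite pAB -(dim_polarity B) => /addnI dimAB.
by apply/addv_idPr/eqP; rewrite eq_sym eqEdim addvSr dimAB /=.
Qed.

Lemma polarity_inj : injective p.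
Proof.
move=> A B pAB; apply/eqP; rewrite eqEsubv.
by apply/andP; split; apply: polarity_sub; rewrite pAB.
Qed.

End Polarity.

(** * Dimensions of [L]-subspaces over the small field *)

Section Restr.
Variables (F : finFieldType) (L0 : fieldExtType F) (k : nat).
Local Notation L := (finvect_type L0).
Implicit Types H : {vspace 'cV[L]_k}.

Lemma card_finvect : #|L| = (#|F| ^ \dim {:L0})%N.
Proof.
rewrite -(eq_card (A := {:L}%VS)) => [|v]; last exact: memvf.
exact: card_vspace.
Qed.

(** Both spaces have the same elements; counting them over [L] and over [F] compares the
    dimensions. *)
Lemma dim_restr H : \dim (restr H) = (\dim {:L0} * \dim H)%N.
Proof.
apply/eqP; rewrite -(eqn_exp2l _ _ (finNzRing_gt1 F)) expnM -card_finvect.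
have <- : #|H| = (#|L| ^ \dim H)%N by apply: card_vspace.
have <- : #|restr H| = (#|F| ^ \dim (restr H))%N by apply: card_vspace.
by apply/eqP; apply: eq_card => v; apply: mem_restr.
Qed.

Lemma dim_colf : \dim {:'cV[L]_k} = k.
Proof. by rewrite dimvf /dim /= muln1. Qed.

Lemma restr_fullv : restr {:'cV[L]_k} = fullv.
Proof. by apply/vspaceP => v; rewrite memvf (mem_restr fullv v) memvf. Qed.

Lemma dim_Fcolf : \dim {:Fcol L0 k} = (\dim {:L0} * k)%N.
Proof. by rewrite -restr_fullv dim_restr dim_colf. Qed.

End Restr.

(** * Complements for the trace form and for the sesquilinear form *)

Section Perp.
Variables (F : finFieldType) (L0 : fieldExtType F) (k : nat).
Local Notation L := (finvect_type L0).
Variable theta : {rmorphism L -> L}.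
Variable sigma : {bilinear 'cV[L]_k -> 'cV[L]_k -> L | *%R & theta \; *%R}.
Hypothesis sigma_nondeg : nondeg_form sigma.

(** Inside [L], the field [F] is the fixed set of a power map, and [theta] commutes with powers. *)
Lemma theta_scalar (c : F) : exists c' : F, theta c%:A = c'%:A.
Proof.
have: theta c%:A \in (1%AS : {subfield L}).
  rewrite Fermat's_little_theorem -rmorphXn; apply/eqP; congr (theta _).
  by apply/eqP; rewrite -Fermat's_little_theorem rpredZ ?mem1v.
by case/vlineP => c' ->; exists c'.
Qed.

Lemma trace_form_scalar (x y : 'cV[L]_k) : trace_form sigma x y \in 1%VS.
Proof. exact: mem_galTrace (finField_galois (sub1v _)) (memvf _). Qed.

Lemma trace_formZr (c : F) (x y : 'cV[L]_k) :
  exists c' : F, trace_form sigma x (c%:A *: y) = c' *: trace_form sigma x y.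
Proof.
have [c' theta_c] := theta_scalar c; exists c'.
rewrite /trace_form linearZr_LR /= theta_c /galTrace scaler_sumr.
by apply: eq_bigr => g _; rewrite mulr_algl linearZ.
Qed.

Lemma trace_formDr (x y z : 'cV[L]_k) :
  trace_form sigma x (y + z) = trace_form sigma x y + trace_form sigma x z.
Proof. by rewrite /trace_form linearDr raddfD. Qed.

(** For nonzero [s] the products [c * s] fill [L], so the trace would vanish identically. As a sum
    of Galois automorphisms with all coefficients 1, it would contradict their linear
    independence. *)
Lemma galTrace_eq0 (s : L) :
  (forall c : L, galTrace 1 {:L} (c * s) = 0) -> s = 0.
Proof.
move=> tr0; apply/eqP; apply: contraT => s0.
have tr0' a : galTrace 1 {:L} a = 0 by rewrite -(divfK s0 a) tr0.
have indep := @gal_independent F L {:L} (mem 'Gal({:L} / 1)%g) (fun=> 1).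
suff /eqP : (1 : L) = 0 by rewrite oner_eq0.
apply: (indep _ 1%g (group1 _)) => a _; rewrite -[RHS](tr0' a).
by apply: eq_bigr => g _; rewrite mul1r.
Qed.

Lemma theta_surj (c : L) : exists b, theta b = c.
Proof.
have [g _ gK] := injF_bij (fmorph_inj theta).
by exists (g c).
Qed.

(** Since [H] is stable under [L], replacing [y] by [b *: y] multiplies [sigma x y] by [theta b],
    which runs through all of [L]. *)
Lemma trace_form_eq0 (x : 'cV[L]_k) (H : {vspace 'cV[L]_k}) :
  (forall y, y \in H -> trace_form sigma x y = 0) ->
  forall y, y \in H -> sigma x y = 0.
Proof.
move=> tr0 y yH; apply: galTrace_eq0 => c; have [b <-] := theta_surj c.
have := tr0 _ (rpredZ b yH).
by rewrite /trace_form linearZr_LR.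
Qed.

Lemma trace_form0r (x : 'cV[L]_k) : trace_form sigma x 0 = 0.
Proof. by rewrite /trace_form linear0r raddf0. Qed.

Lemma perp0 : perp sigma 0 = fullv.
Proof.
apply/vspaceP => x; rewrite memvf; apply/mem_perp => u; rewrite memv0 => /eqP->.
exact: trace_form0r.
Qed.

Lemma perpD (A B : {vspace Fcol L0 k}) :
  perp sigma (A + B) = (perp sigma A :&: perp sigma B)%VS.
Proof.
apply/vspaceP => x; rewrite memv_cap; apply/mem_perp/andP => [xAB|[xA xB] u].
  by split; apply/mem_perp => u uX; apply: xAB;
     apply: subvP uX; rewrite ?addvSl ?addvSr.
case/memv_addP => a aA [b bB ->].
apply: etrans (trace_formDr x a b) _.
by rewrite (mem_perp _ _ _ xA) ?(mem_perp _ _ _ xB) ?addr0.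
Qed.

Lemma perp_full : perp sigma fullv = 0%VS.
Proof.
apply/vspaceP => x; rewrite memv0; apply/idP/eqP => [/mem_perp x0|->];
  last exact: mem0v.
apply: sigma_nondeg => y.
by apply: (@trace_form_eq0 x fullv) (memvf _) => z _; apply: x0; apply: memvf.
Qed.

(** Pairing with [u] is an [F]-linear functional with values in the copy of [F] inside [L], so its
    kernel has codimension at most 1. Pairing with a multiple of [u] only rescales the value, so
    this kernel lies in the complement of the line. *)
Lemma perp_line (u : Fcol L0 k) :
  (\dim {:Fcol L0 k} <= (\dim (perp sigma <[u]>)).+1)%N.
Proof.
pose f (x : Fcol L0 k) : L := trace_form sigma x u.
have f_lin : linear f.
  move=> c x y; apply: etrans (trace_formDl _ _ _ _) _; congr (_ + _).
  exact: trace_formZl.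
pose fl := HB.pack_for {linear Fcol L0 k -> L} f
  (GRing.isLinear.Build F (Fcol L0 k) L *:%R f f_lin).
have ker_perp : (lker (linfun fl) <= perp sigma <[u]>)%VS.
  apply/subvP => x; rewrite memv_ker lfunE /= => /eqP fx0.
  apply/mem_perp => v /vlineP[c ->].
  have [c' Dc'] := trace_formZr c x u; apply: etrans Dc' _.
  by rewrite [trace_form _ _ _]fx0 scaler0.
have im1 : (limg (linfun fl) <= 1)%VS.
  by apply/subvP => _ /memv_imgP[x _ ->]; rewrite lfunE trace_form_scalar.
have := limg_ker_dim (linfun fl) fullv; rewrite capfv => <-.
by rewrite -addn1 leq_add ?dimvS // (leq_trans (dimvS im1)) ?dimv1.
Qed.

Definition dim_perp := dim_polarity perp0 perpD perp_full perp_line.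
Definition perp_sub := polarity_sub perp0 perpD perp_full perp_line.

Definition form_left (u x : 'cV[L]_k) : L^o := sigma x u.

Fact form_left_linear u : linear (form_left u).
Proof. by move=> c x y; rewrite /form_left linearDl linearZl_LR. Qed.

HB.instance Definition _ u :=
  GRing.isLinear.Build L 'cV[L]_k L^o *:%R (form_left u) (form_left_linear u).

(** An intersection of kernels of [L]-linear maps is an [L]-subspace by construction; [sigma] is
    linear only on the left, whence the side. *)
Definition sperp (H : {vspace 'cV[L]_k}) : {vspace 'cV[L]_k} :=
  (\bigcap_(u : 'cV[L]_k | u \in H) lker (linfun (form_left u)))%VS.

Lemma mem_sperp (H : {vspace 'cV[L]_k}) (x : 'cV[L]_k) :
  reflect (forall u, u \in H -> sigma x u = 0) (x \in sperp H).
Proof.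
rewrite memvE; apply: (iffP subv_bigcapP) => xH u uH.
  by have := xH u uH; rewrite -memvE memv_ker lfunE => /eqP.
by rewrite -memvE memv_ker lfunE; apply/eqP; apply: xH.
Qed.

Lemma sperp0 : sperp 0 = fullv.
Proof.
apply/vspaceP => x; rewrite memvf; apply/mem_sperp => u; rewrite memv0 => /eqP->.
exact: linear0r.
Qed.

Lemma sperpD A B : sperp (A + B) = (sperp A :&: sperp B)%VS.
Proof.
apply/vspaceP => x; rewrite memv_cap; apply/mem_sperp/andP => [xAB|[xA xB] u].
  by split; apply/mem_sperp => u uX; apply: xAB;
     apply: subvP uX; rewrite ?addvSl ?addvSr.
case/memv_addP => a aA [b bB ->].
by rewrite linearDr (mem_sperp _ _ xA) ?(mem_sperp _ _ xB) ?addr0.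
Qed.

Lemma sperp_full : sperp fullv = 0%VS.
Proof.
apply/vspaceP => x; rewrite memv0; apply/idP/eqP => [/mem_sperp x0|->];
  last exact: mem0v.
by apply: sigma_nondeg => y; apply: x0; apply: memvf.
Qed.

Lemma sperp_line (u : 'cV[L]_k) : (\dim {:'cV[L]_k} <= (\dim (sperp <[u]>)).+1)%N.
Proof.
pose f : 'Hom('cV[L]_k, L^o) := linfun (form_left u).
have ker_perp : (lker f <= sperp <[u]>)%VS.
  apply/subvP => x; rewrite memv_ker lfunE /= => /eqP fx0.
  apply/mem_sperp => v /vlineP[c ->].
  by rewrite linearZr_LR /= [sigma x u]fx0 mulr0.
rewrite -(limg_ker_dim f fullv) capfv addnC -(add1n (\dim _)).
by rewrite leq_add ?dimvS // (leq_trans (dimvS (subvf _))) ?dimvf.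
Qed.

Definition dim_sperp := dim_polarity sperp0 sperpD sperp_full sperp_line.
Definition sperp_inj := polarity_inj sperp0 sperpD sperp_full sperp_line.

Lemma sperp_surj H : exists H', sperp H' = H.
Proof. by have [g _ gK] := injF_bij sperp_inj; exists (g H). Qed.

Lemma restr_sperp (H : {vspace 'cV[L]_k}) : restr (sperp H) = perp sigma (restr H).
Proof.
apply/vspaceP => x; rewrite (mem_restr (sperp H) x).
apply/mem_sperp/mem_perp => [x0 u | x0].
  rewrite (mem_restr H u) => uH.
  by apply: etrans (congr1 _ (x0 u uH)) _; rewrite raddf0.
by apply: trace_form_eq0 => y yH; apply: x0; rewrite mem_restr.
Qed.

End Perp.

(** * Equivalence of systems *)

Section SystemEquiv.
Variables (F : finFieldType) (L0 : fieldExtType F) (t k : nat).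
Local Notation L := (finvect_type L0).
Implicit Types U V W : 'I_t -> {vspace Fcol L0 k}.

Definition twist (phi : 'M[L]_k) (a : L) (v : Fcol L0 k) : Fcol L0 k :=
  a *: (phi *m (v : 'cV[L]_k)).

Lemma twist_inj phi a : phi \in unitmx -> a != 0 -> injective (twist phi a).
Proof.
move=> phi_unit a0; apply: (can_inj (g := twist (invmx phi) a^-1)) => v.
by rewrite /twist -scalemxAr scalerA mulVf // scale1r mulKmx.
Qed.

(** Equivalence of systems as a pointwise membership condition, with matrix and scalar both on the
    side of [U]. The scalars are therefore the inverses of those in [system_equiv]. *)
Definition twists (phi : 'M[L]_k) (rho : 'S_t) (a : 'I_t -> L) U V : Prop :=
  [/\ phi \in unitmx, forall i, a i != 0 &
      forall i v, (v \in U i) = (twist phi (a i) v \in V (rho i))].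

Lemma system_equivP U V :
  system_equiv U V <-> exists phi rho a, twists phi rho a U V.
Proof.
split=> [[phi [rho [a [phi_unit a0 UV]]]] | [phi [rho [a [phi_unit a0 UV]]]]].
  exists phi, rho, (fun i => (a i)^-1); split=> // [i|i v].
    by rewrite invr_eq0.
  have := UV i => /setP/(_ (phi *m (v : 'cV[L]_k))).
  rewrite mem_imset; last exact: (can_inj (mulKmx phi_unit)).
  move=> ->; rewrite -[phi *m _](scalerKV (a0 i)) mem_imset //.
  exact: can_inj (scalerK (a0 i)).
exists phi, rho, (fun i => (a i)^-1); split=> // [i|i].
  by rewrite invr_eq0.
have a0' : (a i)^-1 != 0 by rewrite invr_eq0.
apply/setP => w; rewrite -{1}(mulKVmx phi_unit w).
rewrite mem_imset; last exact: (can_inj (mulKmx phi_unit)).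
rewrite UV /twist mulKVmx // -[in RHS](scalerK (a0 i) w) mem_imset //.
exact: can_inj (scalerK a0').
Qed.

Lemma system_equiv_sym U V : system_equiv U V -> system_equiv V U.
Proof.
case/system_equivP => phi [rho [a [phi_unit a0 UV]]]; apply/system_equivP.
exists (invmx phi), (rho^-1)%g, (fun j => (a ((rho^-1)%g j))^-1).
split=> [|j|j v]; first by rewrite unitmx_inv.
  by rewrite invr_eq0.
by rewrite UV permKV /twist -scalemxAr scalerA mulfV // scale1r mulKVmx.
Qed.

Lemma system_equiv_trans U V W :
  system_equiv U V -> system_equiv V W -> system_equiv U W.
Proof.
case/system_equivP => phi [rho [a [phi_unit a0 UV]]].
case/system_equivP => psi [tau [b [psi_unit b0 VW]]]; apply/system_equivP.
exists (psi *m phi), (rho * tau)%g, (fun i => b (rho i) * a i).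
split=> [|i|i v]; first by rewrite unitmx_mul psi_unit.
  by rewrite mulf_neq0.
by rewrite UV VW permM /twist -scalemxAr scalerA mulmxA.
Qed.

(** A twist is a bijection, so the two subspaces have equally many elements, and over a finite field
    this determines the dimension. *)
Lemma dim_twist phi a (A B : {vspace Fcol L0 k}) :
    phi \in unitmx -> a != 0 ->
  (forall v, (v \in A) = (twist phi a v \in B)) -> \dim A = \dim B.
Proof.
move=> phi_unit a0 AB; have [f' fK f'K] := injF_bij (twist_inj phi_unit a0).
have card_eq : #|A| = #|B|.
  rewrite -[RHS](on_card_preimset (f := twist phi a)); last first.
    by exists f' => v _; [apply: fK | apply: f'K].
  rewrite -[LHS]cardsE; congr #|pred_of_set _|.
  by apply/setP => v; rewrite !inE AB.
apply/eqP; rewrite -(eqn_exp2l _ _ (finNzRing_gt1 F)).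
have <- : #|A| = (#|F| ^ \dim A)%N by apply: card_vspace.
have <- : #|B| = (#|F| ^ \dim B)%N by apply: card_vspace.
by rewrite card_eq.
Qed.

Definition mulmx_img (phi : 'M[L]_k) (H : {vspace 'cV[L]_k}) : {vspace 'cV[L]_k} :=
  (linfun (mulmx phi : 'cV[L]_k -> 'cV[L]_k) @: H)%VS.

Lemma mem_mulmx_img phi H v : phi \in unitmx ->
  (phi *m v \in mulmx_img phi H) = (v \in H).
Proof.
move=> phi_unit; apply/memv_imgP/idP => [[u uH]|vH].
  by rewrite lfunE => /(can_inj (mulKmx phi_unit)) ->.
by exists v; rewrite ?lfunE.
Qed.

Lemma dim_mulmx_img phi H : phi \in unitmx -> \dim (mulmx_img phi H) = \dim H.
Proof.
move=> phi_unit; apply: limg_dim_eq; apply/eqP; rewrite -subv0.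
apply/subvP => v; rewrite memv_cap memv_ker lfunE /= memv0 => /andP[_ /eqP v0].
by rewrite -(mulKmx phi_unit v) v0 mulmx0.
Qed.

Lemma mulmx_img_inj phi : phi \in unitmx -> injective (mulmx_img phi).
Proof.
move=> phi_unit H1 H2 eqH; apply/vspaceP => v.
by rewrite -!(@mem_mulmx_img phi _ v) ?eqH.
Qed.

Lemma mem_restr_twist phi a H v : phi \in unitmx -> a != 0 ->
  (twist phi a v \in restr (mulmx_img phi H)) = (v \in restr H).
Proof.
move=> phi_unit a0; rewrite (mem_restr (mulmx_img phi H)) (mem_restr H).
by rewrite /twist scalemxAr mem_mulmx_img // rpredZeq (negPf a0).
Qed.

(** An [L]-line inside every [V i] would be carried by the matrix to an [L]-line inside every [U i];
    the block scalars do not move it. *)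
Lemma no_line_equiv U V : system_equiv U V -> no_line U -> no_line V.
Proof.
move=> /system_equiv_sym/system_equivP[phi [rho [a [phi_unit a0 VU]]]] nlU H H1.
have /nlU : \dim (mulmx_img phi H) = 1%N by rewrite dim_mulmx_img.
apply: contra => /subv_bigcapP HV; apply/subv_bigcapP => j _.
have aj0 := a0 ((rho^-1)%g j).
apply/subvP => w wH; have [f' fK f'K] := injF_bij (twist_inj phi_unit aj0).
rewrite -(f'K w) -{2}[j](permKV rho) -VU.
apply: (subvP (HV _ isT)).
by rewrite -(mem_restr_twist _ _ phi_unit aj0) f'K.
Qed.

Definition meet_dim U (H : {vspace 'cV[L]_k}) : nat :=
  (\sum_i \dim (U i :&: restr H))%N.

(** The map is [H |-> phi H]. An [L]-subspace absorbs the block scalars, and the sum over the blocks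
    absorbs the permutation. *)
Lemma meet_dim_equiv U V : system_equiv U V ->
  exists g : {vspace 'cV[L]_k} -> {vspace 'cV[L]_k},
    [/\ injective g, forall H, \dim (g H) = \dim H &
        forall H, meet_dim V (g H) = meet_dim U H].
Proof.
case/system_equivP => phi [rho [a [phi_unit a0 UV]]].
exists (mulmx_img phi); split=> [|H|H]; first exact: mulmx_img_inj.
  exact: dim_mulmx_img.
rewrite /meet_dim (reindex_inj (@perm_inj _ rho)); apply: eq_bigr => i _ /=.
apply/esym; apply: (dim_twist phi_unit (a0 i)) => v.
by rewrite !memv_cap -UV mem_restr_twist.
Qed.

Lemma dim_equiv U V : system_equiv U V ->
  exists rho : 'S_t, forall i, \dim (U i) = \dim (V (rho i)).
Proof.
case/system_equivP => phi [rho [a [phi_unit a0 UV]]]; exists rho => i.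
exact: (dim_twist phi_unit (a0 i) (UV i)).
Qed.

End SystemEquiv.

(** * Adjoints and the dual system *)

Section Duality.
Variables (F : finFieldType) (L0 : fieldExtType F) (t k : nat).
Local Notation L := (finvect_type L0).
Variable theta : {rmorphism L -> L}.
Variable sigma : {bilinear 'cV[L]_k -> 'cV[L]_k -> L | *%R & theta \; *%R}.
Hypothesis sigma_nondeg : nondeg_form sigma.
Implicit Types U V W : 'I_t -> {vspace Fcol L0 k}.

Definition form_mx : 'M[L]_k :=
  \matrix_(i, j) sigma (delta_mx i 0) (delta_mx j 0).

Lemma form_mxE (x y : 'cV[L]_k) :
  sigma x y = (x^T *m form_mx *m map_mx theta y) 0 0.
Proof.
have col_delta (z : 'cV[L]_k) : z = \sum_i z i 0 *: delta_mx i 0.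
  apply/colP => i; rewrite summxE (bigD1 i) //= !mxE !eqxx mulr1 big1 ?addr0 //.
  by move=> j ji; rewrite !mxE eq_sym (negPf ji) mulr0.
rewrite {1}(col_delta x) {1}(col_delta y) linear_sumlz -mulmxA !mxE.
apply: eq_bigr => i _; rewrite linearZl_LR linear_sumr !mxE /=; congr (_ * _).
by apply: eq_bigr => j _; rewrite linearZr_LR !mxE mulrC.
Qed.

Lemma form_mx_unit : form_mx \in unitmx.
Proof.
rewrite -row_free_unit; apply: inj_row_free => v v0.
apply: trmx_inj; rewrite trmx0; apply: sigma_nondeg => y.
by rewrite form_mxE trmxK v0 mul0mx mxE.
Qed.

(** With the Gram matrix [M = form_mx], this is the solution [B] of [x^T B^T M theta(y) = x^T M
    theta(phi) theta(y)] for all [x] and [y]. *)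
Definition adj_mx (phi : 'M[L]_k) : 'M[L]_k :=
  (form_mx *m map_mx theta phi *m invmx form_mx)^T.

Lemma adj_mxP phi x y : sigma (adj_mx phi *m x) y = sigma x (phi *m y).
Proof.
rewrite !form_mxE trmx_mul trmxK map_mxM !mulmxA.
by rewrite mulmxKV ?form_mx_unit.
Qed.

Lemma adj_mx_unit phi : phi \in unitmx -> adj_mx phi \in unitmx.
Proof.
move=> phi_unit; rewrite unitmx_tr !unitmx_mul unitmx_inv form_mx_unit.
by rewrite map_unitmx phi_unit.
Qed.

(** Taking adjoints reverses direction: the adjoint carries the complement of [V (rho i)] to that of
    [U i]. Hence the passage through symmetry, the inverse permutation, and the scalar [theta (a i)]
    coming out of the second argument. *)
Lemma perp_equiv U V : system_equiv U V ->
  system_equiv (fun i => perp sigma (U i)) (fun i => perp sigma (V i)).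
Proof.
case/system_equivP => phi [rho [a [phi_unit a0 UV]]].
apply: system_equiv_sym; apply/system_equivP.
exists (adj_mx phi), (rho^-1)%g, (fun j => theta (a ((rho^-1)%g j))).
split=> [|j|j x]; first exact: adj_mx_unit.
  by rewrite fmorph_eq0.
have [i ->] : exists i, j = rho i by exists ((rho^-1)%g j); rewrite permKV.
rewrite permK.
have formE v : trace_form sigma (twist (adj_mx phi) (theta (a i)) x) v
             = trace_form sigma x (twist phi (a i) v).
  by rewrite /trace_form /twist linearZl_LR linearZr_LR /= adj_mxP.
apply/mem_perp/mem_perp => [xV v vU|xU w wV].
  by apply: etrans (formE v) _; apply: xV; rewrite -UV.
have [f' _ f'K] := injF_bij (twist_inj phi_unit (a0 i)).
rewrite -(f'K w); apply: etrans (esym (formE _)) _; apply: xU.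
by rewrite UV f'K.
Qed.

(** In each block, the complements of [U i] and of [H] meet in the complement of their sum, whose
    dimension follows from that of the intersection. Terms are moved across the equation so that no
    subtraction is truncated. *)
Lemma meet_dim_perp U H :
  (meet_dim (fun i => perp sigma (U i)) (sperp sigma H) + \sum_i \dim (U i)
     + t * (\dim {:L0} * \dim H) = t * (\dim {:L0} * k) + meet_dim U H)%N.
Proof.
have const c : (t * c = \sum_(i < t) c)%N by rewrite sum_nat_const card_ord.
rewrite !const -!big_split; apply: eq_bigr => i _ /=.
rewrite restr_sperp // -perpD //.
have := dim_perp sigma_nondeg (U i + restr H).
have := dimv_sum_cap (U i) (restr H).
rewrite dim_Fcolf dim_restr.
move: (\dim (U i + _)) (\dim (perp _ _)) (\dim (_ :&: _)) (\dim (U i)).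
move: (\dim _ * \dim H)%N (\dim _ * k)%N; clear; lia.
Qed.

(** Spanning is phrased through row functionals vanishing on the dual system because this is what
    the independence of the rows of a generator matrix asks for. *)
Lemma dual_span U (r : 'rV[L]_k) : no_line U ->
  (forall i x, x \in perp sigma (U i) -> r *m (x : 'cV[L]_k) = 0) -> r = 0.
Proof.
move=> nlU r0; pose f : 'Hom('cV[L]_k, 'M[L]_1) := linfun (mulmx r).
(* The kernel of [r] is the complement of some [H]. If [H] is zero the kernel is everything;
   otherwise [H] contains an [L]-line. *)
have [H Hker] := sperp_surj sigma_nondeg (lker f).
suff H0 : H = 0%VS.
  apply/rowP => j; rewrite mxE; have := memvf (delta_mx j 0 : 'cV[L]_k).
  rewrite -(sperp0 sigma) -H0 Hker memv_ker lfunE /= => /eqP/matrixP/(_ 0 0).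
  by rewrite -colE !mxE.
apply/eqP; apply: contraT; rewrite -vpick0 => u0.
have /nlU/negP[] : \dim <[vpick H]> = 1%N by rewrite dim_vline u0.
apply/subv_bigcapP => i _.
have sub_line : (restr <[vpick H]> <= restr H)%VS.
  apply/subvP => v; rewrite (mem_restr H) (mem_restr <[vpick H]>).
  by apply: subvP; rewrite -memvE memv_pick.
(* Reversing inclusions, [H] lies in [U i] because the complement of [U i] lies in the kernel of
   [r]. *)
apply: subv_trans sub_line _; apply: (perp_sub sigma_nondeg).
rewrite -restr_sperp // Hker; apply/subvP => x xU.
by rewrite (mem_restr (lker f)) memv_ker lfunE /= (r0 _ _ xU).
Qed.

End Duality.

(** * Codes and generator matrices *)

Section RowSpan.
Variables (K : fieldType) (p n : nat).
Implicit Type G : 'M[K]_(p, n).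

Definition row_map G : 'Hom('rV[K]_p, 'rV[K]_n) := linfun (mulmxr G).

Lemma span_rows G : <<[seq row a G | a : 'I_p]>>%VS = limg (row_map G).
Proof.
apply/eqP; rewrite eqEsubv; apply/andP; split.
  apply/span_subvP => _ /imageP[a _ ->]; apply/memv_imgP.
  by exists (delta_mx 0 a); rewrite ?memvf // lfunE /= rowE.
apply/subvP => _ /memv_imgP[r _ ->]; rewrite lfunE /= mulmx_sum_row.
by apply: rpred_sum => a _; rewrite rpredZ ?memv_span ?image_f.
Qed.

Lemma mem_span_rowsP G y :
  reflect (exists r, y = r *m G) (y \in <<[seq row a G | a : 'I_p]>>%VS).
Proof.
rewrite span_rows; apply: (iffP memv_imgP) => [[r _ ->]|[r ->]]; exists r;
  by rewrite ?memvf // lfunE.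
Qed.

Lemma free_rows G : free [seq row a G | a : 'I_p] = row_free G.
Proof.
rewrite /free span_rows size_image card_ord.
have := limg_ker_dim (row_map G) fullv; rewrite capfv dimvf /dim /= mul1n => dimG.
have -> : (\dim (limg (row_map G)) == p) = (\dim (lker (row_map G)) == 0)%N.
  by apply/eqP/eqP; move: dimG; move: (\dim _) (\dim _); clear; lia.
rewrite dimv_eq0.
apply/eqP/idP => [ker0|freeG].
  apply: inj_row_free => v vG; apply/eqP; rewrite -memv0 -ker0 memv_ker lfunE /=.
  by rewrite vG.
apply/eqP; rewrite -subv0; apply/subvP => v; rewrite memv_ker lfunE /= memv0.
by rewrite -(mul0mx 1 G) => /eqP/(row_free_inj freeG)->.
Qed.

End RowSpan.

(** * Column spans over the small field *)

Section ColSpan.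
Variables (F : finFieldType) (L0 : fieldExtType F).
Local Notation L := (finvect_type L0).
Local Notation "A ^L" := (map_mx (in_alg L) A) (at level 2).

Definition col_comb k n (M : 'M[L]_(k, n)) (c : 'cV[F]_n) : Fcol L0 k := M *m c^L.

Fact col_comb_linear k n (M : 'M[L]_(k, n)) : linear (col_comb M).
Proof.
move=> a c e; rewrite /col_comb map_mxD mulmxDr; congr (_ + _).
by rewrite map_mxZ -scalemxAr.
Qed.

HB.instance Definition _ k n (M : 'M[L]_(k, n)) :=
  GRing.isLinear.Build F 'cV[F]_n (Fcol L0 k) *:%R (col_comb M) (col_comb_linear M).

Definition colspan k n (M : 'M[L]_(k, n)) : {vspace Fcol L0 k} :=
  <<[seq (col j M : Fcol L0 k) | j : 'I_n]>>%VS.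

Lemma colspanE k n (M : 'M[L]_(k, n)) : colspan M = limg (linfun (col_comb M)).
Proof.
apply/eqP; rewrite eqEsubv; apply/andP; split.
  apply/span_subvP => _ /imageP[a _ ->]; apply/memv_imgP.
  by exists (delta_mx a 0); rewrite ?memvf // lfunE /= /col_comb map_delta_mx colE.
apply/subvP => _ /memv_imgP[c _ ->]; rewrite lfunE /= /col_comb.
have -> : M *m c^L = \sum_j (c j 0 *: (col j M : Fcol L0 k)).
  apply/colP => i; rewrite mxE summxE; apply: eq_bigr => j _.
  by rewrite !mxE mulrC.
by apply: rpred_sum => a _; apply: rpredZ; apply/memv_span/image_f.
Qed.

Lemma mem_colspanP k n (M : 'M[L]_(k, n)) (v : Fcol L0 k) :
  reflect (exists c : 'cV[F]_n, v = M *m c^L) (v \in colspan M).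
Proof.
rewrite colspanE; apply: (iffP memv_imgP) => [[r _ ->]|[r ->]]; exists r;
  by rewrite ?memvf // lfunE.
Qed.

Lemma free_cols_inj k n (M : 'M[L]_(k, n)) (c : 'cV[F]_n) :
  \dim (colspan M) = n -> M *m c^L = 0 -> c = 0.
Proof.
rewrite colspanE => dimM Mc; apply/eqP.
have := limg_ker_dim (linfun (col_comb M)) fullv.
rewrite capfv dimM dimvf /dim /= muln1 => dim_ker.
have /eqP : \dim (lker (linfun (col_comb M))) = 0%N.
  by move: dim_ker; move: (\dim _); clear; lia.
rewrite dimv_eq0 => /eqP ker0.
by rewrite -memv0 -ker0 memv_ker lfunE /= /col_comb Mc.
Qed.

(** Each column of [M'] is an [F]-combination of the columns of [M]; the coefficient vectors are the
    columns of [A]. *)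
Lemma colspan_sub k n p (M : 'M[L]_(k, n)) (M' : 'M[L]_(k, p)) :
  (colspan M' <= colspan M)%VS -> exists A : 'M[F]_(n, p), M' = M *m A^L.
Proof.
move/subvP => sM.
have /fin_all_exists[c Dc] j : exists c : 'cV[F]_n, col j M' = M *m c^L.
  by apply/mem_colspanP/sM/memv_span/image_f.
exists (\matrix_(i, j) c j i 0); apply/matrixP => i j.
have /colP/(_ i) := Dc j; rewrite !mxE => ->.
by apply: eq_bigr => l _; rewrite !mxE.
Qed.

Lemma colspan_cast k n p (e : n = p) (M : 'M[L]_(k, n)) :
  colspan (castmx (erefl k, e) M) = colspan M.
Proof. by case: p / e; rewrite castmx_id. Qed.

Lemma colspan_mulr k n (M : 'M[L]_(k, n)) (A : 'M[F]_n) :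
  A \in unitmx -> colspan (M *m A^L) = colspan M.
Proof.
move=> A_unit; apply/vspaceP => v.
apply/mem_colspanP/mem_colspanP => [[c ->]|[c ->]].
  by exists (A *m c); rewrite map_mxM mulmxA.
by exists (invmx A *m c); rewrite -mulmxA -map_mxM mulKVmx.
Qed.

Lemma mem_colspan_twist k n (M : 'M[L]_(k, n)) (phi : 'M[L]_k) a v :
    phi \in unitmx -> a != 0 ->
  (twist phi a v \in colspan (a *: (phi *m M))) = (v \in colspan M).
Proof.
move=> phi_unit a0; apply/mem_colspanP/mem_colspanP => [[c vc]|[c ->]]; exists c.
  apply: (twist_inj phi_unit a0).
  by rewrite vc /twist -scalemxAl mulmxA.
by rewrite /twist -scalemxAl mulmxA.
Qed.

End ColSpan.

Section Codes.
Variables (F : finFieldType) (L0 : fieldExtType F).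
Local Notation L := (finvect_type L0).
Local Notation "A ^L" := (map_mx (in_alg L) A) (at level 2).
Variables (t : nat) (n : 'I_t -> nat) (k : nat).
Implicit Types (C : {vspace 'rV[L]_(\sum_i n i)}) (G : 'M[L]_(k, \sum_i n i)).

Definition code_of G : {vspace 'rV[L]_(\sum_i n i)} :=
  <<[seq row a G | a : 'I_k]>>%VS.

Definition system_of G (i : 'I_t) : {vspace Fcol L0 k} := colspan (submxrow G i).

Lemma generatorP C G : generator C G <-> C = code_of G /\ row_free G.
Proof.
rewrite /generator /basis_of free_rows eq_sym.
by split=> [/andP[/eqP ? ?] | [-> ->]]; rewrite ?eqxx.
Qed.

Lemma generator_dim C G : generator C G -> \dim C = k.
Proof. by case/andP=> /eqP <- /eqnP ->; rewrite size_image card_ord. Qed.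

(** Two bases of one code differ by an invertible matrix on the left, which acts on all blocks at
    once and so serves as the linear map between the systems. *)
Lemma generator_equiv C G G' : generator C G -> generator C G' ->
  system_equiv (system_of G) (system_of G').
Proof.
case/generatorP => -> Gfree /generatorP[GG' G'free].
have /fin_all_exists[P DP] (a : 'I_k) : exists r, row a G' = r *m G.
  by apply/mem_span_rowsP; rewrite -/(code_of G) GG'; apply/memv_span/image_f.
have DG' : G' = (\matrix_a P a) *m G.
  by apply/row_matrixP => a; rewrite DP row_mul rowK.
have P_unit : \matrix_a P a \in unitmx.
  rewrite -row_free_unit; apply: inj_row_free => v vP.
  by apply: (row_free_inj G'free); rewrite DG' mulmxA vP !mul0mx.
apply/system_equivP; exists (\matrix_a P a), 1%g, (fun=> 1).
split=> // [i|i v]; first exact: oner_neq0.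
rewrite perm1 /system_of DG' -mul_submxrow.
rewrite -(mem_colspan_twist (submxrow G i) v P_unit (oner_neq0 L)).
by rewrite scale1r.
Qed.

Section BlockMap.
Variables (pi : 'S_t) (npi : forall i, n (pi i) = n i).
Variables (a : 'I_t -> L) (A : forall i, 'M[F]_(n i)).

(** The same formula as [block_map] for any number of rows, so that an isometry can be applied to a
    whole generator matrix. *)
Definition block_mx p (X : 'M[L]_(p, \sum_i n i)) : 'M[L]_(p, \sum_i n i) :=
  \mxrow_i (a i *: (castmx (erefl p, npi i) (submxrow X (pi i)) *m (A i)^L)).

Lemma mulmx_castr p q l l' (e : l = l') (R : 'M[L]_(p, q)) (B : 'M_(q, l)) :
  castmx (erefl p, e) (R *m B) = R *m castmx (erefl q, e) B.
Proof. by case: l' / e; rewrite !castmx_id. Qed.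

Lemma block_mxM p q (R : 'M[L]_(p, q)) (X : 'M[L]_(q, \sum_i n i)) :
  block_mx (R *m X) = R *m block_mx X.
Proof.
rewrite /block_mx mul_mxrow; apply: eq_mxrow => i.
by rewrite -mul_submxrow mulmx_castr -scalemxAr mulmxA.
Qed.

Lemma block_mapM (r : 'rV[L]_k) G : block_map npi a A (r *m G) = r *m block_mx G.
Proof. exact: block_mxM. Qed.

Lemma image_code_of G G' : G' = block_mx G ->
  [set y in code_of G'] = [set block_map npi a A x | x in code_of G].
Proof.
move=> DG'; apply/setP => y; rewrite inE.
apply/mem_span_rowsP/imsetP => [[r ->] | [_ /mem_span_rowsP[r ->] ->]].
  by exists (r *m G); [apply/mem_span_rowsP; exists r | rewrite block_mapM DG'].
by exists r; rewrite block_mapM DG'.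
Qed.

Hypothesis a_neq0 : forall i, a i != 0.
Hypothesis A_unit : forall i, A i \in unitmx.

Lemma block_mx_inj p (X : 'M[L]_(p, \sum_i n i)) : block_mx X = 0 -> X = 0.
Proof.
move/mxrowP => X0; apply/mxrowP => j.
have [i ->] : exists i, j = pi i by exists ((pi^-1)%g j); rewrite permKV.
have /eqP := X0 i; rewrite mxrowK !submxrow0.
rewrite scaler_eq0 (negPf (a_neq0 i)) /= => /eqP XA.
have {XA} : castmx (erefl p, npi i) (submxrow X (pi i)) = 0.
  have AL_unit : (A i)^L \in unitmx by rewrite map_unitmx.
  by rewrite -[LHS](mulmxK AL_unit) XA mul0mx.
move/(congr1 (castmx (esym (erefl p), esym (npi i)))); rewrite castmxK => ->.
by apply/matrixP => x y; rewrite castmxE !mxE.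
Qed.

(** The matrices [A i] only change the [F]-basis of a column span, and block scalars and
    permutations are allowed in an equivalence of systems. Block [i] of the image comes from block
    [pi i], so the equivalence is built from the image back to [G]. *)
Lemma system_of_block_mx G : system_equiv (system_of G) (system_of (block_mx G)).
Proof.
apply: system_equiv_sym; apply/system_equivP.
exists 1%:M, pi, (fun i => (a i)^-1); split=> [|i|i v].
- exact: unitmx1.
- by rewrite invr_eq0.
rewrite /system_of mxrowK -(colspan_cast (npi i)).
rewrite -(colspan_mulr (castmx _ _) (A_unit i)).
have a0' : (a i)^-1 != 0 by rewrite invr_eq0.
rewrite -(mem_colspan_twist _ v (unitmx1 _ _) a0').
by rewrite mul1mx scalerA mulVf // scale1r.
Qed.

End BlockMap.

Lemma code_equiv_generator C C' G : code_equiv C C' -> generator C G ->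
  exists G', generator C' G' /\ system_equiv (system_of G) (system_of G').
Proof.
move=> [pi [npi [a [A [a0 A_unit CC']]]]] /generatorP[DC Gfree].
exists (block_mx npi a A G); split; last exact: system_of_block_mx.
apply/generatorP; split.
  apply/vspaceP => y; have := image_code_of (erefl (block_mx npi a A G)).
  by rewrite -DC -CC' => /setP/(_ y); rewrite !inE.
apply: inj_row_free => v; rewrite -block_mxM => /(block_mx_inj a0 A_unit) vG.
by apply: (row_free_inj Gfree); rewrite vG mul0mx.
Qed.

(** The linear map becomes a change of basis of the code, and the two bases of each [F]-space of
    columns are related by an invertible matrix over [F], which gives the isometry. *)
Lemma code_equiv_of_systems G G' :
    (forall i, \dim (system_of G i) = n i) ->
    (forall i, \dim (system_of G' i) = n i) ->
  system_equiv (system_of G) (system_of G') ->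
  code_equiv (code_of G) (code_of G').
Proof.
move=> dimG dimG' /system_equivP[phi [rho [a [phi_unit a0 twGG']]]].
have nrho i : n (rho i) = n i.
  by rewrite -(dimG i) -(dimG' (rho i)) (dim_twist phi_unit (a0 i) (twGG' i)).
(* Systems send block [i] to block [rho i], while an isometry reads its block [i] from block
   [pi i]. *)
pose pi := (rho^-1)%g; have npi i : n (pi i) = n i by rewrite -nrho permKV.
pose X i := a (pi i) *: castmx (erefl k, npi i) (submxrow (phi *m G) (pi i)).
have XE i : colspan (X i) = system_of G' i.
  have -> : X i = castmx (erefl k, npi i) (a (pi i) *: (phi *m submxrow G (pi i))).
    rewrite mul_submxrow /X.
    by apply/matrixP => x y; rewrite !(castmxE, mxE).
  rewrite colspan_cast; apply/vspaceP => v.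
  have [f' _ f'K] := injF_bij (twist_inj phi_unit (a0 (pi i))).
  by rewrite -(f'K v) mem_colspan_twist // -/(system_of G (pi i)) twGG' permKV.
have /fin_all_exists[A DA] i :
    exists A : 'M[F]_(n i), submxrow G' i = X i *m A^L.
  by apply: colspan_sub; rewrite XE.
(* A kernel vector of [A i] would be an [F]-relation between the independent columns of block [i] of
   [G']. *)
have A_unit i : A i \in unitmx.
  rewrite -unitmx_tr -row_free_unit; apply: inj_row_free => v vA.
  apply: trmx_inj; rewrite trmx0; apply: (free_cols_inj (dimG' i)).
  rewrite DA -mulmxA -map_mxM -[A i]trmxK -trmx_mul vA.
  by rewrite trmx0 map_mx0 mulmx0.
exists pi, npi, (fun i => a (pi i)), A; split=> //.
have -> : code_of G = code_of (phi *m G).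
  apply/vspaceP => y; apply/mem_span_rowsP/mem_span_rowsP => [[r ->]|[r ->]].
    by exists (r *m invmx phi); rewrite mulmxA mulmxKV.
  by exists (r *m phi); rewrite mulmxA.
apply: image_code_of; apply/mxrowP => i.
by rewrite mxrowK DA /X scalemxAl.
Qed.

End Codes.

(** * The geometric dual *)

Section AssociatedSystems.
Variables (F : finFieldType) (L0 : fieldExtType F) (t k : nat).
Local Notation L := (finvect_type L0).
Implicit Types U V : 'I_t -> {vspace Fcol L0 k}.

Lemma system_equiv_ext U V : U =1 V -> system_equiv U V.
Proof.
move=> UV; apply/system_equivP; exists 1%:M, 1%g, (fun=> 1).
split=> [|i|i v]; [exact: unitmx1 | exact: oner_neq0 |].
by rewrite perm1 /twist mul1mx scale1r UV.
Qed.

Lemma assoc_systemP n (C : {vspace 'rV[L]_(\sum_i n i)}) U G :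
  assoc_system C U -> generator C G -> system_equiv (system_of G) U.
Proof.
move=> [_ [G1 [U1 [CG1 U1E U1U]]]] CG.
apply: system_equiv_trans U1U; apply: system_equiv_trans (generator_equiv CG CG1) _.
by apply: system_equiv_ext => i; rewrite U1E.
Qed.

Lemma assoc_system_unique n (C : {vspace 'rV[L]_(\sum_i n i)}) U V :
  assoc_system C U -> assoc_system C V -> system_equiv U V.
Proof.
move=> CU CV; have [_ [G [_ [CG _ _]]]] := CU.
apply: system_equiv_trans (assoc_systemP CV CG).
exact: system_equiv_sym (assoc_systemP CU CG).
Qed.

Lemma assoc_system_equiv n (C C' : {vspace 'rV[L]_(\sum_i n i)}) U V :
  code_equiv C C' -> assoc_system C U -> assoc_system C' V -> system_equiv U V.
Proof.
move=> CC' CU C'V; have [_ [G [_ [CG _ _]]]] := CU.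
have [G' [C'G' GG']] := code_equiv_generator CC' CG.
apply: system_equiv_trans (assoc_systemP C'V C'G').
exact: system_equiv_trans (system_equiv_sym (assoc_systemP CU CG)) GG'.
Qed.

(* Equivalence only matches the dimensions up to a permutation of the blocks;
   since a block never spans more than its length, comparing the sums removes
   the permutation. *)
Lemma dim_system_of n (G : 'M[L]_(k, \sum_i n i)) U :
    (forall i, \dim (U i) = n i) -> system_equiv U (system_of G) ->
  forall i, \dim (system_of G i) = n i.
Proof.
move=> dimU /dim_equiv[rho dimG].
have le_dim i :
    true -> (\dim (system_of G i) <= n i ?= iff (\dim (system_of G i) == n i))%N.
  move=> _; split=> //; apply: leq_trans (dim_span _) _.
  by rewrite size_image card_ord.
have sum_dim : (\sum_i \dim (system_of G i) = \sum_i n i)%N.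
  rewrite (reindex_inj (@perm_inj _ rho)); apply: eq_bigr => j _ /=.
  by rewrite -dimG dimU.
have [_] := leqif_sum le_dim; rewrite sum_dim eqxx => /esym/forallP eq_dim i.
exact/eqP/eq_dim.
Qed.

Lemma basis_matrix (W : {vspace Fcol L0 k}) p : \dim W = p ->
  exists M : 'M[L]_(k, p), basis_of W [seq (col j M : Fcol L0 k) | j : 'I_p].
Proof.
move=> dimW; pose M : 'M[L]_(k, p) := \matrix_(i, j) ((vbasis W)`_j : 'cV[L]_k) i 0.
exists M; have -> : [seq (col j M : Fcol L0 k) | j : 'I_p] = vbasis W;
  last exact: vbasisP.
apply: (@eq_from_nth _ 0) => [|i]; rewrite size_image card_ord.
  by rewrite size_tuple dimW.
move=> ip; rewrite (nth_map (Ordinal ip)) -?enumT ?size_enum_ord //.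
by apply/colP => j; rewrite !mxE nth_enum_ord.
Qed.

Lemma assoc_code_exists n U : (forall i, \dim (U i) = n i) ->
  exists C : {vspace 'rV[L]_(\sum_i n i)}, assoc_code U C.
Proof.
move=> dimU; have [M MU] := fin_all_exists (fun i => basis_matrix (dimU i)).
pose G : 'M[L]_(k, \sum_i n i) := \mxrow_i M i.
exists (code_of G), G, (code_of G).
have GU i : basis_of (U i) (block_cols G i) by rewrite /block_cols mxrowK.
have dimG i : \dim (system_of G i) = n i.
  by rewrite -dimU -(span_basis (GU i)).
split=> //; apply: code_equiv_of_systems => //.
exact: system_equiv_ext.
Qed.

End AssociatedSystems.

(** * Enumerators as sums over subspaces *)

Section Weights.
Variables (F : finFieldType) (L0 : fieldExtType F) (t k : nat).
Local Notation L := (finvect_type L0).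
Variables (n : 'I_t -> nat) (U : 'I_t -> {vspace Fcol L0 k}).
Hypothesis dimU : forall i, \dim (U i) = n i.
Local Notation N := (\sum_i n i)%N.

Lemma meet_dim_le H : (meet_dim U H <= N)%N.
Proof. by apply: leq_sum => i _; rewrite -dimU dimvS ?capvSl. Qed.

(** Grouping the subspaces by weight recovers the coefficients. A sum over subspaces can be
    reindexed along a bijection, which is how duality enters. *)
Lemma weight_enumE r :
  weight_enum n U r = \sum_(H : {vspace 'cV[L]_k} | (\dim H + r == k)%N)
    ('X%:P ^+ meet_dim U H * 'X ^+ (N - meet_dim U H)).
Proof.
have wt_lt H : (sys_wt n U H < N.+1)%N by rewrite ltnS leq_subr.
rewrite (partition_big (fun H => Ordinal (wt_lt H)) xpredT) //=.
apply: eq_bigr => w _; rewrite mulr_natl -sumr_const.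
apply: eq_big => [H|H]; first by rewrite inE -val_eqE /= [(w : nat) == _]eq_sym.
rewrite inE => /andP[_ /eqP->]; rewrite /sys_wt -/(meet_dim U H).
by rewrite subKn // meet_dim_le.
Qed.

End Weights.

Section GeometricDual.
Variables (F : finFieldType) (L0 : fieldExtType F) (t k : nat).
Local Notation L := (finvect_type L0).
Variable theta : {rmorphism L -> L}.
Variable sigma : {bilinear 'cV[L]_k -> 'cV[L]_k -> L | *%R & theta \; *%R}.
Hypothesis sigma_nondeg : nondeg_form sigma.
Implicit Types U V : 'I_t -> {vspace Fcol L0 k}.

(** Reduces a geometric dual to a generator matrix whose system is equivalent to the complement of a
    system of [C]. The rows are independent by [dual_span], and the block lengths are the sizes of
    bases of the complements. *)
Lemma geometric_dual_generator n n' (C : {vspace 'rV[L]_(\sum_i n i)})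
    (D : {vspace 'rV[L]_(\sum_i n' i)}) :
  geometric_dual sigma C D ->
  exists U G, [/\ assoc_system C U, generator D G,
    forall i, (n' i + n i = k * \dim {:L0})%N,
    system_equiv (fun i => perp sigma (U i)) (system_of G) &
    forall i, \dim (system_of G i) = n' i].
Proof.
move=> [U [CU nlU [G1 [D1 [G1U D1E D1D]]]]].
have sysG1 i : system_of G1 i = perp sigma (U i) by rewrite -(span_basis (G1U i)).
have dimG1 i : \dim (perp sigma (U i)) = n' i.
  have /andP[/eqP <- /eqnP ->] := G1U i.
  by rewrite size_image card_ord.
have D1G1 : generator D1 G1.
  apply/generatorP; split=> //; apply: inj_row_free => r rG1.
  apply: (dual_span sigma_nondeg nlU) => i x; rewrite -sysG1.
  by case/mem_colspanP => c ->; rewrite mulmxA mul_submxrow rG1 submxrow0 mul0mx.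
have [G [DG G1G]] := code_equiv_generator D1D D1G1.
have UG : system_equiv (fun i => perp sigma (U i)) (system_of G).
  by apply: system_equiv_trans G1G; apply: system_equiv_ext => i; rewrite sysG1.
exists U, G; split=> // [i|]; last exact: dim_system_of UG.
have [[dimU _] _] := CU.
by rewrite -dimG1 -(dimU i) dim_perp // dim_Fcolf mulnC.
Qed.

(** The map takes the complement with respect to [sigma] and then follows the equivalence with
    [V]. *)
Lemma perp_meet U V : system_equiv (fun i => perp sigma (U i)) V ->
  exists g : {vspace 'cV[L]_k} -> {vspace 'cV[L]_k},
    [/\ injective g, forall H, (\dim (g H) + \dim H = k)%N &
      forall H, (meet_dim V (g H) + \sum_i \dim (U i) + t * (\dim {:L0} * \dim H)
                 = t * (\dim {:L0} * k) + meet_dim U H)%N].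
Proof.
case/meet_dim_equiv => g [g_inj dim_g meet_g]; exists (g \o sperp sigma); split.
- exact: inj_comp g_inj (sperp_inj sigma_nondeg).
- by move=> H /=; rewrite dim_g dim_sperp // dim_colf.
by move=> H /=; rewrite meet_g meet_dim_perp.
Qed.

End GeometricDual.

(** The shifts [p] and [q] may be negative, so the comparison of monomials takes place in a field
    with nonzero [x] and [y]. *)
Lemma laurent_shift (K : fieldType) (x y : K) (a b c d : nat) (p q : int) :
    x != 0 -> y != 0 -> a%:Z = p + b%:Z -> c%:Z = q + d%:Z ->
  x ^+ a * y ^+ c = x ^ p * y ^ q * (x ^+ b * y ^+ d).
Proof.
by move=> x0 y0 Da Dc; rewrite !exprnP Da Dc !expfzDr // mulrACA.
Qed.

(** * Weights of a system and of its dual *)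

Section DualWeights.
Variables (F : finFieldType) (L0 : fieldExtType F) (t k : nat).
Local Notation L := (finvect_type L0).
Variables (m : nat) (n n' : 'I_t -> nat) (U U' : 'I_t -> {vspace Fcol L0 k}).
Hypothesis dimU : forall i, \dim (U i) = n i.
Hypothesis dimU' : forall i, \dim (U' i) = n' i.
Hypothesis nn' : forall i, (n' i + n i = k * m)%N.
Local Notation N := (\sum_i n i)%N.
Local Notation N' := (\sum_i n' i)%N.
Variable g : {vspace 'cV[L]_k} -> {vspace 'cV[L]_k}.
Hypothesis g_inj : injective g.
Hypothesis dim_g : forall H, (\dim (g H) + \dim H = k)%N.
Hypothesis meet_g : forall H,
  (meet_dim U' (g H) + N + t * (m * \dim H) = t * (m * k) + meet_dim U H)%N.

Lemma dual_total : (N' + N = t * (m * k))%N.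
Proof.
rewrite -big_split /= (eq_bigr _ (fun i _ => nn' i)) sum_nat_const card_ord.
by rewrite (mulnC k).
Qed.

Lemma dual_weight_enum r : (1 <= r <= k - 1)%N ->
  let X : {fraction {poly {poly int}}} := FracField.tofrac 'X%:P in
  let Y : {fraction {poly {poly int}}} := FracField.tofrac 'X in
  FracField.tofrac (weight_enum n' U' r) =
    X ^ ((t * m * k)%:Z - (t * r * m)%:Z - N%:Z) * Y ^ ((t * r * m)%:Z - N%:Z) *
    FracField.tofrac (weight_enum n U (k - r)).
Proof.
move=> r_bound X Y; rewrite !weight_enumE // (reindex_inj g_inj) /=.
have X0 : X != 0 by rewrite /X tofrac_eq0 polyC_eq0 polyX_eq0.
have Y0 : Y != 0 by rewrite /Y tofrac_eq0 polyX_eq0.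
set p := (_ - _ - _); set q := ((t * r * m)%:Z - _).
(* Since [g] exchanges dimension and codimension, [g H] has codimension [r] exactly when [H] has
   codimension [k - r]. The monomials are then compared one subspace at a time. *)
rewrite !rmorph_sum mulr_sumr; apply: eq_big => [H|H].
  have := dim_g H; move: (\dim H) (\dim (g H)) r_bound => a b; clear.
  by move=> rk abk; apply/eqP/eqP; lia.
move=> /eqP dimgH; rewrite !rmorphM !rmorphXn /= -/X -/Y.
have dimH : \dim H = r.
  by have := dim_g H; move: dimgH; move: (\dim _) (\dim _); clear; lia.
rewrite {}/p {}/q; have := meet_g H; rewrite dimH.
have := meet_dim_le dimU H; have := meet_dim_le dimU' (g H).
have := dual_total.
have -> : (t * m * k = t * (m * k))%N by rewrite mulnA.
have -> : (t * r * m = t * (m * r))%N by rewrite -mulnA (mulnC r).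
move: (t * (m * k))%N (t * (m * r))%N N N' (meet_dim _ _) (meet_dim _ _).
move=> a b c d e f dca ed fc eq_ef.
clearbody X Y; apply: (laurent_shift X0 Y0); move: dca ed fc eq_ef; clear; lia.
Qed.

Lemma dual_gen_weight : (2 <= k)%N ->
  (gen_weight n U 1)%:Z =
    (gen_weight n' U' (k - 1))%:Z + N%:Z - (t * (k - 1) * m)%:Z.
Proof.
move=> k2; rewrite /gen_weight.
have [g' gK g'K] := injF_bij g_inj.
(* A line and its preimage, a hyperplane, show that both maxima range over nonempty families; an
   empty maximum would be 0 and not attained. *)
pose e : 'cV[L]_k := delta_mx (Ordinal (ltnW k2)) 0.
have e0 : e != 0.
  apply/eqP => /matrixP/(_ (Ordinal (ltnW k2)) 0)/eqP.
  by rewrite !mxE !eqxx oner_eq0.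
have dime : \dim <[e]> = 1%N by rewrite dim_vline e0.
pose P1 := [pred H : {vspace 'cV[L]_k} | (\dim H + (k - 1) == k)%N].
pose P2 := [pred H : {vspace 'cV[L]_k} | (\dim H + 1 == k)%N].
have P1e : P1 <[e]>%VS by rewrite inE /= dime; lia.
have P12 H : P1 (g H) = P2 H.
  rewrite !inE /=; have := dim_g H; have := k2.
  move: (\dim _) (\dim _); clear=> a b k_ge2 abk.
  by apply/eqP/eqP; lia.
have P1_gt0 : (0 < #|P1|)%N by apply/card_gt0P; exists <[e]>%VS.
have [H1 P1H1 max1] := eq_bigmax_cond (meet_dim U') P1_gt0.
have P2e : P2 (g' <[e]>%VS) by rewrite -P12 g'K.
have P2_gt0 : (0 < #|P2|)%N by apply/card_gt0P; exists (g' <[e]>%VS).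
have [H2 P2H2 max2] := eq_bigmax_cond (meet_dim U) P2_gt0.
rewrite [X in (N - X)%N]max2 [X in (N' - X)%N]max1.
have P2g' : P2 (g' H1) by rewrite -P12 g'K.
have P1g : P1 (g H2) by rewrite P12.
(* Each maximiser is transported to the other side and compared with the maximum there; the two
   inequalities give equality. *)
have := @leq_bigmax_cond _ P1 (meet_dim U') _ P1g; rewrite [X in (_ <= X)%N]max1.
have := @leq_bigmax_cond _ P2 (meet_dim U) _ P2g'; rewrite [X in (_ <= X)%N]max2.
have := meet_g H2; have := meet_g (g' H1); rewrite g'K.
have -> : \dim H2 = (k - 1)%N.
  by move: P2H2; rewrite inE /=; move: (\dim _); clear; lia.
have -> : \dim (g' H1) = (k - 1)%N.
  by move: P2g'; rewrite inE /=; move: (\dim _); clear; lia.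
have := meet_dim_le dimU H2; have := meet_dim_le dimU' H1; have := dual_total.
have -> : (t * (k - 1) * m = t * (m * (k - 1)))%N by rewrite -mulnA (mulnC m).
move: (t * (m * k))%N (t * (m * (k - 1)))%N N N'.
move: (meet_dim _ _) (meet_dim _ _) (meet_dim _ _) (meet_dim _ _).
clear; lia.
Qed.

End DualWeights.

Theorem theorem3p4 (F : finFieldType) (L : fieldExtType F) (m : nat)
    (hm : \dim {:L} = m)
    (k : nat) (hk : (2 <= k)%N)
    (theta : {rmorphism finvect_type L -> finvect_type L})
    (sigma : {bilinear 'cV[finvect_type L]_k -> 'cV[finvect_type L]_k
                -> finvect_type L | *%R & theta \; *%R})
    (sigma_nondeg : nondeg_form sigma) (sigma_refl : reflexive_form sigma)
    (t : nat) (n : 'I_t -> nat) (N : nat) (hN : N = (\sum_i n i)%N)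
    (C : {vspace 'rV[finvect_type L]_(\sum_i n i)}) (d : nat)
    (C_dim : \dim C = k) (C_nondeg : nondegenerate_code k C)
    (C_dist : min_distance C d)
    (U : 'I_t -> {vspace Fcol L k})
    (CU : assoc_system C U) (U_no_line : no_line U) :
  let dual_len := fun i : 'I_t => (k * m - n i)%N in
  [/\ (forall C' : {vspace 'rV[finvect_type L]_(\sum_i n i)},
         code_equiv C C' ->
         (forall U' : 'I_t -> {vspace Fcol L k}, assoc_system C' U' ->
            no_line U' /\
            exists D' : {vspace 'rV[finvect_type L]_(\sum_i dual_len i)},
              assoc_code (fun i => perp sigma (U' i)) D') /\
         (forall D D' : {vspace 'rV[finvect_type L]_(\sum_i dual_len i)},
            geometric_dual sigma C D -> geometric_dual sigma C' D' ->
            code_equiv D D')),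
      (forall (n' : 'I_t -> nat)
              (D : {vspace 'rV[finvect_type L]_(\sum_i n' i)}),
         geometric_dual sigma C D ->
         [/\ forall i, (n i <= k * m)%N /\ n' i = dual_len i,
             \dim D = k & nondegenerate_code k D]),
      (forall (D : {vspace 'rV[finvect_type L]_(\sum_i dual_len i)})
              (U' : 'I_t -> {vspace Fcol L k}) (r : nat),
         geometric_dual sigma C D -> assoc_system D U' ->
         (1 <= r <= k - 1)%N ->
         let X : {fraction {poly {poly int}}} := FracField.tofrac 'X%:P in
         let Y : {fraction {poly {poly int}}} := FracField.tofrac 'X in
         FracField.tofrac (weight_enum dual_len U' r) =
           X ^ ((t * m * k)%:Z - (t * r * m)%:Z - N%:Z) *
           Y ^ ((t * r * m)%:Z - N%:Z) *
           FracField.tofrac (weight_enum n U (k - r)))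
    & (forall (D : {vspace 'rV[finvect_type L]_(\sum_i dual_len i)})
              (U' : 'I_t -> {vspace Fcol L k}),
         geometric_dual sigma C D -> assoc_system D U' ->
         (gen_weight n U 1)%:Z =
           (gen_weight dual_len U' (k - 1))%:Z + N%:Z
             - (t * (k - 1) * m)%:Z)].
Proof.
move=> dual_len; subst m N.
have [[dimU _] _] := CU.
(* This makes the truncated subtraction in [dual_len] exact. *)
have nkm i : (n i <= k * \dim {:L})%N.
  by rewrite -dimU mulnC -dim_Fcolf dimvS ?subvf.
have dim_perpU V i : \dim (V i) = n i -> \dim (perp sigma (V i)) = dual_len i.
  move=> dimV; have := dim_perp sigma_nondeg (V i).
  by rewrite dimV dim_Fcolf mulnC /dual_len => <-; rewrite addnK.
have dual_map D U' : geometric_dual sigma C D -> assoc_system D U' ->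
    system_equiv (fun i => perp sigma (U i)) U'.
  case/(geometric_dual_generator sigma_nondeg) => U1 [G [CU1 DG _ U1G _]] DU'.
  apply: system_equiv_trans (assoc_systemP DU' DG).
  apply: system_equiv_trans U1G.
  exact/(perp_equiv sigma_nondeg)/(assoc_system_unique CU CU1).
have nn' i : (dual_len i + n i = k * \dim {:L})%N by rewrite subnK.
split.
- move=> C' CC'; split=> [U' C'U'|D D'].
    split; first exact: no_line_equiv (assoc_system_equiv CC' CU C'U') U_no_line.
    have [[dimU' _] _] := C'U'.
    by apply: assoc_code_exists => i; apply: dim_perpU.
  move=> /(geometric_dual_generator sigma_nondeg)[U1 [G [CU1 DG _ U1G dimG]]].
  move=> /(geometric_dual_generator sigma_nondeg)[V1 [G' [C'V1 D'G' _ V1G' dimG']]].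
  have [-> _] := (generatorP _ _).1 DG; have [-> _] := (generatorP _ _).1 D'G'.
  apply: code_equiv_of_systems => //.
  (* Equivalent codes have equivalent systems, hence equivalent dual systems; both duals are read
     off from these. *)
  apply: system_equiv_trans V1G'.
  apply: system_equiv_trans (system_equiv_sym U1G) _.
  exact/(perp_equiv sigma_nondeg)/(assoc_system_equiv CC' CU1 C'V1).
- move=> n' D /(geometric_dual_generator sigma_nondeg)[U1 [G [_ DG n'n _ dimG]]].
  split=> [i||G2 DG2 i]; last 2 first.
  + exact: generator_dim DG.
  (* Nondegeneracy concerns every generator matrix: another one yields an equivalent system, and the
     block dimensions are then forced. *)
  + rewrite /free size_image card_ord; apply/eqP.
    exact: (dim_system_of dimG (generator_equiv DG DG2)).
  by split; rewrite // /dual_len -(n'n i) addnK.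
- move=> D U' r CD DU' r_bound.
  have [g [g_inj dim_g meet_g]] := perp_meet sigma_nondeg (dual_map _ _ _ CD DU').
  have [[dimU' _] _] := DU'.
  apply: (dual_weight_enum dimU dimU' nn' g_inj dim_g) => // H.
  by rewrite -meet_g (eq_bigr _ (fun i _ => dimU i)).
move=> D U' CD DU'.
have [g [g_inj dim_g meet_g]] := perp_meet sigma_nondeg (dual_map _ _ _ CD DU').
have [[dimU' _] _] := DU'.
apply: (dual_gen_weight dimU dimU' nn' g_inj dim_g) => // H.
by rewrite -meet_g (eq_bigr _ (fun i _ => dimU i)).
Qed.
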